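(* Let $\{e_1,e_2,\dots,e_r\}$ be a set of (distinct) primitive idempotents of $R=\mathbb{F}_q[H]$ and $e=e_1+e_2+\dots+e_r$. Then every $1$-generator $H$-quasi-abelian code in $\mathbb{F}_q[G]$ having $e$ as its idempotent generator is generated (under the identification of $\mathbb{F}_q[G]$ with $S=\mathbb{F}_{q^l}[H]$) by an element of the form $$A_1+A_2+\dots+A_r,$$ where, for each $j=1,\dots,r$, $A_j\in (Se_j)^*$ is of the form $$A_j=\pi_{j,t}^{\nu_t}+\pi_{j,t+1}^{\nu_{t+1}}+\dots+\pi_{j,s_j}^{\nu_{s_j}}$$ for some $1\le t\le s_j$, $0\le\nu_t\le L_j-1$, and $\nu_{t+1},\dots,\nu_{s_j}\in T_j$ (with $t$ and the exponents depending on $j$).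
   Context: Let $\mathbb{F}_q$ be a finite field with $q$ elements, $G$ a finite abelian group (written additively), $H\le G$ a subgroup of index $l=[G:H]$, with $\gcd(q,|H|)=1$. Group ring elements are written $\sum_g\alpha_gY^g$. Let $R=\mathbb{F}_q[H]$ and $S=\mathbb{F}_{q^l}[H]\supseteq R$. An idempotent is a nonzero element $e$ with $e^2=e$; an idempotent $e$ is primitive if for every other idempotent $f$ either $ef=e$ or $ef=0$. An $H$-quasi-abelian code in $\mathbb{F}_q[G]$ is an $R$-submodule of $\mathbb{F}_q[G]$; it is of $1$-generator if it is a cyclic $R$-module. Fix representatives $\mathfrak{g}_1,\dots,\mathfrak{g}_l$ of the cosets of $H$ in $G$ and a basis $\{\alpha_1,\dots,\alpha_l\}$ of $\mathbb{F}_{q^l}$ over $\mathbb{F}_q$. The maps $\Phi:\mathbb{F}_q[G]\to R^l$, $\sum_{h\in H}\sum_{i=1}^l \alpha_{h+\mathfrak{g}_i}Y^{h+\mathfrak{g}_i}\mapsto\left(\sum_{h}\alpha_{h+\mathfrak{g}_1}Y^h,\dots,\sum_{h}\alpha_{h+\mathfrak{g}_l}Y^h\right)$, and $\varphi:R^l\to S$, $(a_1,\dots,a_l)\mapsto\sum_{i=1}^l\alpha_ia_i$, are $R$-module isomorphisms. The code generated by $A=\varphi(\boldsymbol a)\in S$ is $RA\subseteq S$, viewed as $R\boldsymbol{a}\subseteq R^l$ or as $\Phi^{-1}(R\boldsymbol a)\subseteq\mathbb{F}_q[G]$. Its idempotent generator is the idempotent $e\in R$ with $Re=Ra_1+\dots+Ra_l$.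 For each $j$, $(Se_j)^*$ is the set of nonzero elements of $Se_j$; $e_j=e_{j1}+\dots+e_{js_j}$ is the decomposition of $e_j$ as a sum of distinct primitive idempotents of $S$; $k_j=\dim_{\mathbb{F}_q}(Re_j)$; $d_j=\dim_{\mathbb{F}_{q^l}}(Se_{j1})$ (one has $d_j=k_j/\gcd(l,k_j)$, $s_j=\gcd(l,k_j)$, and each $Se_{ji}$ is a field of $q^{ld_j}$ elements with identity $e_{ji}$). For each $i=1,\dots,s_j$, $\pi_{j,i}$ is a fixed primitive element (generator of the multiplicative group) of the field $Se_{ji}$, with the conventions $\pi_{j,i}^0=e_{ji}$ and $\pi_{j,i}^\infty=0$. Set $L_j=\frac{q^{ld_j}-1}{q^{k_j}-1}$ and $T_j=\{\infty,0,1,\dots,q^{ld_j}-2\}$. *)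

(* Defs.v *)
From HB Require Import structures.
From mathcomp Require Import all_boot all_order all_algebra all_fingroup all_field.

Set Implicit Arguments.
Unset Strict Implicit.
Unset Printing Implicit Defensive.

Import GRing.Theory.
Local Open Scope ring_scope.

(* The group algebra F[gT], for a finite group gT in multiplicative notation:
   x : {ffun gT -> F} stands for \sum_g (x g) Y^g, and the product is
   convolution.  An alias is needed because {ffun gT -> F} already carries
   pointwise multiplication. *)
Definition grpalg (F : fieldType) (gT : finGroupType) : Type :=
  {ffun gT -> F^o}.

HB.instance Definition _ (F : fieldType) (gT : finGroupType) :=
  Vector.copy (grpalg F gT) {ffun gT -> F^o}.

Section GroupAlgebra.

Variables (F : fieldType) (gT : finGroupType).
Implicit Types x y z : grpalg F gT.

Definition ga_coef x (g : gT) : F := fun_of_fin x g.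

Definition ga_of (f : gT -> F) : grpalg F gT := [ffun g => f g].

Lemma ga_ofE f g : ga_coef (ga_of f) g = f g.
Proof. exact: ffunE. Qed.

Lemma gaP x y : (forall g, ga_coef x g = ga_coef y g) -> x = y.
Proof. by move=> h; apply/ffunP. Qed.

Lemma ga_coefD x y g : ga_coef (x + y) g = ga_coef x g + ga_coef y g.
Proof. exact: ffunE. Qed.

Lemma ga_coefZ a x g : ga_coef (a *: x) g = a * ga_coef x g.
Proof. exact: ffunE. Qed.

Lemma ga_coef0 g : ga_coef 0 g = 0.
Proof. exact: ffunE. Qed.

Definition ga_one : grpalg F gT := ga_of (fun g => (g == 1%g)%:R).

Definition ga_mul x y : grpalg F gT :=
  ga_of (fun g => \sum_(h : gT) ga_coef x h * ga_coef y (h^-1 * g)%g).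

Lemma ga_mulA : associative ga_mul.
Proof.
move=> x y z; apply: gaP => g; rewrite !ga_ofE.
under eq_bigr => h _ do rewrite ga_ofE mulr_sumr.
under [RHS]eq_bigr => k _ do rewrite ga_ofE mulr_suml.
rewrite [RHS]exchange_big; apply: eq_bigr => h _ /=.
rewrite [RHS](reindex_inj (mulgI h)); apply: eq_bigr => k _ /=.
by rewrite mulKg invMg !mulgA mulrA.
Qed.

Lemma ga_mul1 : left_id ga_one ga_mul.
Proof.
move=> x; apply: gaP => g; rewrite ga_ofE (bigD1 1%g) //= ga_ofE eqxx mul1r.
by rewrite invg1 mul1g big1 ?addr0 // => h /negPf h1; rewrite ga_ofE h1 mul0r.
Qed.

Lemma ga_mulr1 : right_id ga_one ga_mul.
Proof.
move=> x; apply: gaP => g; rewrite ga_ofE (bigD1 g) //= ga_ofE mulVg eqxx mulr1.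
rewrite big1 ?addr0 // => h hg; rewrite ga_ofE -eq_mulVg1 (negPf hg).
by rewrite mulr0.
Qed.

Lemma ga_mulDl : left_distributive ga_mul +%R.
Proof.
move=> x y z; apply: gaP => g; rewrite ga_coefD !ga_ofE -big_split.
by apply: eq_bigr => h _; rewrite ga_coefD mulrDl.
Qed.

Lemma ga_mulDr : right_distributive ga_mul +%R.
Proof.
move=> x y z; apply: gaP => g; rewrite ga_coefD !ga_ofE -big_split.
by apply: eq_bigr => h _; rewrite ga_coefD mulrDr.
Qed.

Lemma ga_one_neq0 : ga_one != 0.
Proof.
apply/eqP => /(congr1 (fun x => ga_coef x 1%g))/eqP.
by rewrite ga_ofE ga_coef0 eqxx oner_eq0.
Qed.

HB.instance Definition _ := GRing.Zmodule_isNzRing.Build (grpalg F gT)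
  ga_mulA ga_mul1 ga_mulr1 ga_mulDl ga_mulDr ga_one_neq0.

Lemma ga_mulE x y g :
  ga_coef (x * y) g = \sum_(h : gT) ga_coef x h * ga_coef y (h^-1 * g)%g.
Proof. exact: ga_ofE. Qed.

Lemma ga_scaleAl a x y : a *: (x * y) = (a *: x) * y.
Proof.
apply: gaP => g; rewrite ga_coefZ !ga_mulE mulr_sumr.
by apply: eq_bigr => h _; rewrite ga_coefZ mulrA.
Qed.

Lemma ga_scaleAr a x y : a *: (x * y) = x * (a *: y).
Proof.
apply: gaP => g; rewrite ga_coefZ !ga_mulE mulr_sumr.
by apply: eq_bigr => h _; rewrite ga_coefZ mulrCA.
Qed.

HB.instance Definition _ :=
  GRing.Lmodule_isLalgebra.Build F (grpalg F gT) ga_scaleAl.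
HB.instance Definition _ :=
  GRing.Lalgebra_isAlgebra.Build F (grpalg F gT) ga_scaleAr.
HB.instance Definition _ := Algebra_isFalgebra.Build F (grpalg F gT).

End GroupAlgebra.

Section Idempotents.

Variables (F : fieldType) (A : falgType F).

Definition is_idempotent (e : A) : Prop := e != 0 /\ e * e = e.

Definition primitive_idempotent (e : A) : Prop :=
  is_idempotent e /\
  (forall f : A, is_idempotent f -> e * f = e \/ e * f = 0).

(* The ideal A a = {x * a | x in A}. *)
Definition principal (a : A) : {vspace A} := limg (amulr a).

(* Powers in the ring A e, whose unit is e and not 1: exponent 0 gives e.
   The exponent infinity is None. *)
Definition epow (e p : A) (nu : option nat) : A :=
  match nu with
  | None => 0
  | Some 0%N => e
  | Some n => p ^+ n
  end.

(* For A e a field with identity e. *)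
Definition primitive_element (e p : A) : Prop :=
  [/\ p \in principal e, p != 0 &
      forall x, x \in principal e -> x != 0 ->
        exists n : nat, x = epow e p (Some n)].

End Idempotents.

Section QuasiAbelian.

Variables (F : fieldType) (K : fieldExtType F).
Variables (G : finGroupType) (H : {group G}) (l : nat).

Local Notation FG := (grpalg F G).
Local Notation R := (grpalg F (subg_of H)).
Local Notation S := (grpalg K (subg_of H)).

(* The inclusion of F[H] in F[G]. *)
Definition ga_incl (x : R) : FG :=
  ga_of (fun g : G => \sum_(h : subg_of H | sgval h == g) ga_coef x h).

(* The inclusion of F[H] in K[H]. *)
Definition ga_ext (x : R) : S :=
  ga_of (fun h : subg_of H => (ga_coef x h)%:A : K).

(* C is an R-submodule of F[G]; being a subspace is no restriction since
   R contains F. *)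
Definition quasi_abelian_code (C : {vspace FG}) : Prop :=
  forall (x : R) (c : FG), c \in C -> ga_incl x * c \in C.

Definition one_generator_code (C : {vspace FG}) : Prop :=
  quasi_abelian_code C /\
  exists c0 : FG, forall c : FG,
    c \in C <-> exists x : R, c = ga_incl x * c0.

Definition coset_representatives (g : 'I_l -> G) : Prop :=
  injective (fun i => (H :* g i)%g) /\
  [set (H :* g i)%g | i : 'I_l] = rcosets H [set: G].

Definition Phi (g : 'I_l -> G) (x : FG) : 'rV[R]_l :=
  \row_i (ga_of (fun h : subg_of H => ga_coef x (sgval h * g i)%g)).

Definition phi (alpha : l.-tuple K) (a : 'rV[R]_l) : S :=
  \sum_(i < l) tnth alpha i *: ga_ext (a 0 i).

(* C is the code generated by a in R^l, i.e. C = Phi^-1 (R a). *)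
Definition generated_by_row (g : 'I_l -> G) (a : 'rV[R]_l)
    (C : {vspace FG}) : Prop :=
  forall c : FG, c \in C <-> exists x : R, Phi g c = x *: a.

(* C is the code generated by A in S, i.e. phi (Phi C) = R A. *)
Definition generated_by (g : 'I_l -> G) (alpha : l.-tuple K) (A : S)
    (C : {vspace FG}) : Prop :=
  forall c : FG, c \in C <-> exists x : R, phi alpha (Phi g c) = ga_ext x * A.

(* R e = R a_1 + ... + R a_l for some generator a of C; R a_1 + ... + R a_l
   does not depend on the choice of the generator. *)
Definition has_idempotent_generator (g : 'I_l -> G) (C : {vspace FG})
    (e : R) : Prop :=
  is_idempotent e /\
  exists a : 'rV[R]_l, generated_by_row g a C /\
    principal e = (\sum_(i < l) principal (a 0%R i))%VS.

(* eS lists e_1, ..., e_s, the distinct primitive idempotents of S with sum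
   e; the indices 1, ..., s become 0, ..., s - 1. *)
Definition primitive_decomposition (e : R) (eS : seq S) : Prop :=
  [/\ uniq eS, forall f, f \in eS -> primitive_idempotent f &
      ga_ext e = \sum_(f <- eS) f].

End QuasiAbelian.

(* The division is exact when k divides l * d, as is the case for k = k_j and
   d = d_j, where l d_j = lcm(l, k_j). *)
Definition Lnum (q l k d : nat) : nat := ((q ^ (l * d) - 1) %/ (q ^ k - 1))%N.

(* Membership in {infinity, 0, 1, ..., q^(l d) - 2}, with infinity = None. *)
Definition in_T (q l d : nat) (nu : option nat) : bool :=
  if nu is Some n then (n <= q ^ (l * d) - 2)%N else true.

(* A = pi_t^(nu_t) + pi_(t+1)^(nu_(t+1)) + ... + pi_s^(nu_s); here nut is the
   finite exponent at t and nu gives the exponents at i > t. *)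
Definition component_form (F : fieldType) (A : falgType F) (q l k : nat)
    (eS : seq A) (pi : nat -> A) (a : A) : Prop :=
  let d := \dim (principal eS`_0) in
  let s := size eS in
  exists (t nut : nat) (nu : nat -> option nat),
    [/\ (t < s)%N,
        (nut <= Lnum q l k d - 1)%N,
        forall i, (t < i < s)%N -> in_T q l d (nu i) &
        a = epow eS`_t (pi t) (Some nut)
            + \sum_(t.+1 <= i < s) epow eS`_i (pi i) (nu i)].

(* Main.v *)
Require Import Defs.
From HB Require Import structures.
From mathcomp Require Import all_boot all_order all_algebra all_fingroup all_field.
From mathcomp Require Import cyclic.

Set Implicit Arguments.
Unset Strict Implicit.
Unset Printing Implicit Defensive.

Import GRing.Theory.
Local Open Scope ring_scope.

(**
A generator a in R^l of the code gives the generator A = phi a of the image of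
the code in S.  The code with idempotent generator e has e A = A, hence
A = \sum_j e_j A, and e_j A is nonzero for each j because e_j a = 0 would force
e_j to kill Re, which contains e_j.  Multiplying A by \sum_j x_j with x_j a unit
of the field Re_j does not change the code, as the sum of the inverses of the
x_j undoes it, and it multiplies each e_j A by x_j.  The theorem therefore
reduces to one e_j: some x_j brings e_j A to the required form
(component_normal_form).

Let t be the first index for which the component of e_j A in Se_jt is nonzero.
That component is a power of pi_jt, and x |-> x e_jt embeds the group of units
of Re_j, of order q^(k_j) - 1, in the cyclic group generated by pi_jt, of order
q^(l d_j) - 1.  This subgroup consists of the powers of pi_jt
whose exponent is divisible by the index L_j, so an element of it reduces the
exponent at t below L_j (subgroup_exponent).  The other components are
arbitrary.

Two facts make this work.  First, the corners at primitive idempotents are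
fields.  As q is prime to |H|, a suitable power Q of q is 1 modulo |H|, and then
x^Q = x on the whole group algebra (ga_frobenius): raising to the power Q is
additive, fixes the scalars and fixes H.  Thus x^(Q-1) is idempotent, and for a
nonzero x in the corner at a primitive e it can only be e (corner_inverse).
Second, all the corners Se_j1, ..., Se_js have the same size, so that one d_j
serves them all.  If M is the size of Se_ji, then raising to the power M fixes
Re_j and K, since both embed in the field Se_ji; being additive it fixes all of
Se_j, which Re_j spans over K.  Hence every other Se_ji' has at most M elements
(power_fixes_component, corner_dim_le).
*)

(** * Counting vectors over a field with a finite list of elements *)

(** The field is given by a list of its elements, and not as a finite type, so
    that the lemma applies first to K over F and then to S over K. *)
Lemma vspace_enum (K : fieldType) (sK : seq K) (vT : vectType K)
    (V : {vspace vT}) :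
  uniq sK -> (forall c, c \in sK) ->
  exists s : seq vT, [/\ uniq s, s =i V & size s = (size sK ^ \dim V)%N].
Proof.
move=> sK_uniq sK_full; pose T := seq_sub sK.
pose lc (c : {ffun 'I_(\dim V) -> T}) := \sum_i ssval (c i) *: (vbasis V)`_i.
have lc_inj : injective lc.
  move=> c c' eq_cc'; apply/ffunP => i; apply: val_inj.
  have fV : free (vbasis V) := basis_free (vbasisP V).
  have := congr1 (coord (vbasis V) i) eq_cc'.
  by rewrite !coord_sum_free.
exists [seq lc c | c : {ffun 'I_(\dim V) -> T}]; split.
- by rewrite map_inj_uniq ?enum_uniq.
- move=> v; apply/imageP/idP => [[c _ ->]|Vv].
    by apply: memv_suml => i _; rewrite memvZ // vbasis_mem // mem_nth ?size_tuple.
  exists [ffun i => SeqSub (sK_full (coord (vbasis V) i v))] => //.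
  rewrite {1}(coord_vbasis Vv); apply: eq_bigr => i _; by rewrite ffunE.
- by rewrite size_image card_ffun card_ord card_seq_sub.
Qed.

(** * Subgroups of a finite cyclic group, in terms of exponents *)

(** P n stands for the n-th power of a generator of a cyclic group of order N,
    and U for a subgroup.  Working with the sequence of powers allows the unit
    of the group, P 0, to be an idempotent different from 1. *)
Section CyclicExponents.

Variables (A : nzRingType) (P : nat -> A) (N : nat) (U : seq A).
Hypotheses (N_gt0 : (0 < N)%N) (PD : forall m n, P (m + n)%N = P m * P n).
Hypotheses (PN : P N = P 0%N).
Hypothesis P_inj : forall m n, (m < N)%N -> (n < N)%N -> P m = P n -> m = n.
Hypotheses (U_uniq : uniq U) (U1 : P 0%N \in U).
Hypothesis UP : forall x, x \in U -> exists2 n, (n < N)%N & x = P n.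
Hypothesis UM : forall x y, x \in U -> y \in U -> x * y \in U.

Lemma periodM k m : P (k * N + m)%N = P m.
Proof.
elim: k => [//|k IHk]; rewrite mulSn -addnA PD PN -PD add0n; exact: IHk.
Qed.

(** The least positive D with P D in U divides every exponent of U, so D is the
    index N / |U|, and multiplication by U reduces exponents modulo D. *)
Lemma subgroup_exponent m :
  exists2 w, w \in U & exists2 n, (n < N %/ size U)%N & w * P m = P n.
Proof.
have exD : exists D, (0 < D)%N && (P D \in U) by exists N; rewrite N_gt0 PN.
case: (ex_minnP exD) => D /andP[D_gt0 UD] minD {exD}.
have UDk k : P (k * D)%N \in U.
  by elim: k => [|k IHk]; rewrite ?mul0n // mulSn PD UM.
(* P (n %/ D * (N.-1 * D)) is the inverse of P (n %/ D * D), written as a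
   power of P D to show that it belongs to U. *)
have PmodD n : P (n %/ D * (N.-1 * D))%N * P n = P (n %% D)%N.
  rewrite -PD -[RHS](periodM (n %/ D * D)) {2}(divn_eq n D) addnA -mulnDr.
  by rewrite -mulSnr prednK // (mulnC N) mulnA.
have Uinv n : P (n %/ D * (N.-1 * D))%N \in U by rewrite mulnA UDk.
have dvdD n : P n \in U -> (D %| n)%N.
  move=> Un; rewrite /dvdn; apply/negPn/negP; rewrite -lt0n => r_gt0.
  have: (D <= n %% D)%N by rewrite minD // r_gt0 -PmodD UM.
  by rewrite leqNgt ltn_pmod.
have D_N : (D %| N)%N by rewrite dvdD ?PN.
have lt_iD i : (i < N %/ D)%N -> (i * D < N)%N by rewrite ltn_divRL.
have sizeU : size U = (N %/ D)%N.
  rewrite -(size_iota 0 (N %/ D)) -(size_map (fun i => P (i * D)%N)).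
  apply/eqP; rewrite -uniq_size_uniq => //.
    rewrite map_inj_in_uniq ?iota_uniq // => i j.
    rewrite !mem_iota !add0n /= => /lt_iD ltiN /lt_iD ltjN /(P_inj ltiN ltjN).
    by move/eqP; rewrite eqn_pmul2r // => /eqP.
  move=> x; apply/mapP/idP => [[i _ ->]|Ux]; first exact: UDk.
  have [n lt_nN def_x] := UP Ux; exists (n %/ D)%N.
    by rewrite mem_iota add0n ltn_divRL // divnK // dvdD // -def_x.
  by rewrite divnK // dvdD -?def_x.
exists (P (m %/ D * (N.-1 * D))%N); first exact: Uinv.
exists (m %% D)%N; last exact: PmodD.
by rewrite sizeU divnA // mulKn // ltn_pmod.
Qed.

End CyclicExponents.

(** * Corner rings of primitive idempotents *)

Section Corners.

Variables (F : fieldType) (A : falgType F).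
(* Commutativity is a property here, because group algebras acquire it only from
   a hypothesis on the group. *)
Hypothesis mulC : forall x y : A, x * y = y * x.

Lemma memv_principal (a x : A) : reflect (exists y, x = y * a) (x \in principal a).
Proof.
apply: (iffP memv_imgP) => [[y _ ->]|[y ->]].
  by exists y; rewrite lfunE.
by exists y; rewrite ?memvf // lfunE.
Qed.

Lemma idem_principal (e x : A) : e * e = e -> (x \in principal e) = (x * e == x).
Proof.
move=> ee; apply/memv_principal/eqP => [[y ->]|<-]; last by exists x.
by rewrite -mulrA ee.
Qed.

Lemma primitive_orthogonal (e f : A) :
  primitive_idempotent e -> primitive_idempotent f -> e <> f -> e * f = 0.
Proof.
move=> [id_e prim_e] [id_f prim_f] neq_ef.
have [def_e|//] := prim_e f id_f; rewrite mulC.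
have [def_f|//] := prim_f e id_e.
by case: neq_ef; rewrite -def_e mulC def_f.
Qed.

Lemma cpowD (e p : A) : e * e = e ->
  forall m n, e * p ^+ (m + n)%N = e * p ^+ m * (e * p ^+ n).
Proof.
move=> ee m n; rewrite exprD -mulrA (mulrA _ e) (mulC _ e) -(mulrA e (p ^+ m)).
by rewrite (mulrA e e) ee.
Qed.

Lemma epow_corner (e p : A) n : e * e = e -> p \in principal e ->
  epow e p (Some n) = e * p ^+ n.
Proof.
move=> ee; rewrite idem_principal // => /eqP pe.
case: n => [|n]; rewrite ?expr0 ?mulr1 //=.
by rewrite exprS mulrA (mulC e) pe.
Qed.

Variable Q : nat.
Hypotheses (Q_gt1 : (1 < Q)%N) (frobQ : forall x : A, x ^+ Q = x).

(** Since x^Q = x, the power x^(Q-1) is an idempotent of the corner at e that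
    fixes x; by primitivity it is e, and x^(Q-2) inverts x. *)
Lemma corner_inverse (e x : A) : primitive_idempotent e ->
  x \in principal e -> x != 0 -> exists2 y, y \in principal e & y * x = e.
Proof.
move=> [[e0 ee] prim_e]; rewrite idem_principal // => /eqP xe x0.
have def_Q : Q = Q.-2.+2 by case: Q Q_gt1 => [|[]].
have xQ : x ^+ Q.-1 * x = x by rewrite -exprSr prednK ?frobQ // ltnW.
have id_xQ : is_idempotent (x ^+ Q.-1).
  split; first by apply: contra_neq x0 => x0; rewrite -xQ x0 mul0r.
  by rewrite {2}def_Q /= exprS mulrA xQ -exprS {2}def_Q.
have xQe : x ^+ Q.-1 * e = x ^+ Q.-1 by rewrite def_Q /= exprSr -mulrA xe.
exists (x ^+ Q.-2 * e).
  by rewrite idem_principal // -mulrA ee.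
rewrite -mulrA (mulC e) xe -exprSr.
have [def_e|eq0] := prim_e _ id_xQ.
  by rewrite -def_e mulC xQe {2}def_Q.
by case: id_xQ => /eqP[]; rewrite -xQe mulC eq0.
Qed.

Lemma corner_integral (e x y : A) : primitive_idempotent e ->
  x \in principal e -> y \in principal e -> x * y = 0 -> x = 0 \/ y = 0.
Proof.
move=> prim_e ex ey xy0; have [->|x0] := eqVneq x 0; [by left | right].
have [z _ zx] := corner_inverse prim_e ex x0.
have [[_ ee] _] := prim_e; move: ey; rewrite idem_principal // => /eqP <-.
by rewrite mulC -zx -mulrA xy0 mulr0.
Qed.

(** The powers of p in the corner at e enumerate its nonzero elements, so their
    exact period is the number of these, the size of the corner minus one. *)
Lemma primitive_element_order (e p : A) (s : seq A) :
    primitive_idempotent e -> primitive_element e p ->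
    uniq s -> s =i principal e ->
  [/\ (0 < (size s).-1)%N, e * p ^+ (size s).-1 = e,
      forall m n, (m < (size s).-1)%N -> (n < (size s).-1)%N ->
        e * p ^+ m = e * p ^+ n -> m = n
    & forall x, x \in principal e -> x != 0 ->
        exists2 n, (n < (size s).-1)%N & x = e * p ^+ n].
Proof.
move=> prim_e [ep p0 genp] s_uniq s_mem.
have [[e0 ee] _] := prim_e; have Ee x : (x \in principal e) = (x * e == x).
  exact: idem_principal.
have [q eq qp] := corner_inverse prim_e ep p0.
have pe : p * e = p by apply/eqP; rewrite -Ee.
pose P n := e * p ^+ n; have PD m n : P (m + n)%N = P m * P n by exact: cpowD.
have EP n : P n \in principal e by rewrite Ee /P mulC mulrA ee.
have P_unit n : exists z, z * P n = e.
  elim: n => [|n [z zP]]; first by exists e; rewrite /P expr0 mulr1.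
  have PS : P n.+1 = p * P n by rewrite /P exprS !mulrA (mulC e).
  exists (z * q); rewrite PS -mulrA (mulrA q) qp mulrA (mulC z).
  by rewrite -mulrA zP; exact: ee.
have P_neq0 n : P n != 0.
  by have [z zP] := P_unit n; apply: contra_neq e0 => P0; rewrite -zP P0 mulr0.
have P_cancel m n : P (m + n)%N = P m -> P n = e.
  have [z zP] := P_unit m; rewrite PD => /(congr1 ( *%R z)).
  by rewrite mulrA zP /P mulrA ee.
have exN : exists N, (0 < N)%N && (P N == e).
  exists Q.-1; rewrite -ltnS prednK ?Q_gt1 ?(ltnW Q_gt1) //=.
  by apply/eqP/(P_cancel 1%N); rewrite /P add1n prednK ?(ltnW Q_gt1) // frobQ.
case: (ex_minnP exN) => N /andP[N_gt0 /eqP PN] minN {exN}.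
have P_inj m n : (m < N)%N -> (n < N)%N -> P m = P n -> m = n.
  wlog le_mn : m n / (m <= n)%N => [IH lt_mN lt_nN eqP|_ lt_nN].
    by have [/IH|/ltnW/IH] := leqP m n; [apply | move=> h; apply/esym/h].
  rewrite -{1}(subnKC le_mn) => /esym/P_cancel Pk; apply/eqP.
  rewrite eqn_leq le_mn leqNgt -subn_gt0; apply/negP => k_gt0.
  have := minN (n - m)%N; rewrite k_gt0 Pk eqxx => /(_ isT).
  by rewrite leqNgt (leq_ltn_trans (leq_subr _ _)).
have P_mod n : P n = P (n %% N)%N.
  rewrite {1}(divn_eq n N); elim: (n %/ N)%N => [//|k IHk].
  by rewrite mulSn -addnA PD PN -IHk mulC; apply/eqP; rewrite -Ee.
have gen x : x \in principal e -> x != 0 -> exists2 n, (n < N)%N & x = P n.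
  move=> ex x0; have [n ->] := genp x ex x0; exists (n %% N)%N.
    exact: ltn_pmod.
  by rewrite -P_mod epow_corner.
have -> : (size s).-1 = N; last by split.
rewrite -(size_iota 0 N) -(size_map P) -[RHS]/(size (0 :: map P (iota 0 N))).-1.
congr _.-1; apply/eqP; rewrite -uniq_size_uniq => //=.
  apply/andP; split; first by apply/mapP => -[n _ /esym/eqP]; apply/negP/P_neq0.
  rewrite map_inj_in_uniq ?iota_uniq // => i j.
  by rewrite !mem_iota !add0n => /P_inj h /h.
move=> x; rewrite inE s_mem; apply/predU1P/idP => [[->|/mapP[n _ ->]]|ex] //.
  exact: mem0v.
have [->|x0] := eqVneq x 0; [by left | right].
by have [n lt_nN ->] := gen x ex x0; rewrite map_f // mem_iota add0n.
Qed.

End Corners.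

(** * Group algebras of commutative groups over finite fields *)

Lemma exprD_pcharX (A : nzRingType) (p : nat) (x y : A) n :
  p \in [pchar A] -> x * y = y * x ->
  (x + y) ^+ (p ^ n) = x ^+ (p ^ n) + y ^+ (p ^ n).
Proof.
move=> charA cxy; elim: n => [|n IHn]; first by rewrite !expr1.
rewrite expnSr !exprM IHn -!(pFrobenius_autE charA) pFrobenius_autD_comm //.
by apply: commrX; apply/commr_sym/commrX/commr_sym.
Qed.

Section GroupAlgebra.

Variables (F : fieldType) (gT : finGroupType).
Hypothesis mulgC : forall a b : gT, (a * b = b * a)%g.

Lemma ga_mulC (x y : grpalg F gT) : x * y = y * x.
Proof.
apply: gaP => g; rewrite !ga_mulE.
have inj_h : injective (fun h : gT => h^-1 * g)%g.
  by move=> h h' /mulIg /invg_inj.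
rewrite (reindex_inj inj_h); apply: eq_bigr => h _ /=.
by rewrite invMg invgK -mulgA (mulgC h) mulKg mulrC.
Qed.

Definition ga_basis (g : gT) : grpalg F gT := ga_of (fun h => (h == g)%:R).

Lemma ga_expand (x : grpalg F gT) : x = \sum_g ga_coef x g *: ga_basis g.
Proof.
apply: gaP => g; rewrite (big_morph (fun y => ga_coef y g) (id1 := 0) (op1 := +%R)).
- rewrite (bigD1 g) //= ga_coefZ ga_ofE eqxx mulr1 big1 ?addr0 // => h neq_hg.
  by rewrite ga_coefZ ga_ofE eq_sym (negPf neq_hg) mulr0.
- by move=> y z; rewrite ga_coefD.
- exact: ga_coef0.
Qed.

Lemma ga_basisM g h : ga_basis g * ga_basis h = ga_basis (g * h)%g.
Proof.
apply: gaP => k; rewrite ga_mulE (bigD1 g) //= !ga_ofE eqxx mul1r.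
rewrite big1 ?addr0 => [|i /negPf neq_ig]; last by rewrite ga_ofE neq_ig mul0r.
by rewrite -(inj_eq (mulgI g)) mulKVg.
Qed.

Lemma ga_basisX g n : ga_basis g ^+ n = ga_basis (g ^+ n)%g.
Proof.
elim: n => [|n IHn]; last by rewrite exprS expgS IHn ga_basisM.
by apply: gaP => h; rewrite expr0 expg0 !ga_ofE.
Qed.

Lemma ga_sumX (p n : nat) (I : finType) (E : I -> grpalg F gT) :
  p \in [pchar F] ->
  (\sum_i E i) ^+ (p ^ n) = \sum_i E i ^+ (p ^ n).
Proof.
move=> charF; apply: (big_morph (fun y => y ^+ (p ^ n))).
  by move=> x y; rewrite (@exprD_pcharX _ p) ?pchar_lalg // ga_mulC.
have /andP[p_pr _] := charF.
by rewrite expr0n eqn0Ngt expn_gt0 prime_gt0.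
Qed.

(** Q = p^(n m), with m the totient of |gT|, is 1 modulo |gT| by Euler's theorem
    and a power of p^n.  Raising to the power Q thus fixes both the coefficients
    and the group elements, and it is additive in characteristic p. *)
Lemma ga_frobenius (p n : nat) :
    p \in [pchar F] -> (0 < n)%N -> (forall c : F, c ^+ (p ^ n) = c) ->
    coprime p #|gT| ->
  exists2 Q, (1 < Q)%N & forall x : grpalg F gT, x ^+ Q = x.
Proof.
move=> charF n_gt0 fixF co_p; have /andP[p_pr _] := charF.
have gT_gt0 : (0 < #|gT|)%N by apply/card_gt0P; exists 1%g.
set m := (n * totient #|gT|)%N; exists (p ^ m)%N.
  by rewrite -{1}(expn0 p) ltn_exp2l ?prime_gt1 // muln_gt0 n_gt0 totient_gt0.
move=> x; rewrite {1}(ga_expand x) ga_sumX // [RHS]ga_expand.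
apply: eq_bigr => g _; rewrite exprZn ga_basisX; congr (_ *: ga_basis _).
  rewrite /m expnM; elim: totient => [|k IHk]; first by rewrite expn0 expr1.
  by rewrite expnS exprM fixF.
have g_ord : (g ^+ #|gT| = 1)%g by rewrite -cardsT expg_cardG ?inE.
rewrite -(expg_mod _ g_ord) /m expnM Euler_exp_totient ?coprimeXl //.
by rewrite (expg_mod 1 g_ord) expg1.
Qed.

End GroupAlgebra.

(** * Extension of scalars *)

Section ScalarExtension.

Variables (F : fieldType) (K : fieldExtType F) (G : finGroupType).
Variable (H : {group G}).

Local Notation R := (grpalg F (subg_of H)).
Local Notation S := (grpalg K (subg_of H)).

Fact ga_ext_is_zmod_morphism : zmod_morphism (@ga_ext F K G H).
Proof.
move=> x y; apply: gaP => h.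
have coefB (L : fieldType) (u v : grpalg L (subg_of H)) :
    ga_coef (u - v) h = ga_coef u h - ga_coef v h.
  by rewrite ga_coefD -scaleN1r ga_coefZ mulN1r.
by rewrite ga_ofE !coefB !ga_ofE scalerBl.
Qed.

HB.instance Definition _ := GRing.isZmodMorphism.Build R S (@ga_ext F K G H)
  ga_ext_is_zmod_morphism.

Fact ga_ext_is_monoid_morphism : monoid_morphism (@ga_ext F K G H).
Proof.
split=> [|x y]; apply: gaP => h; rewrite !ga_ofE.
  by case: eqP => _; rewrite ?scale1r ?scale0r.
rewrite scaler_suml; apply: eq_bigr => k _.
by rewrite !ga_ofE -scalerAl mul1r scalerA.
Qed.

HB.instance Definition _ := GRing.isMonoidMorphism.Build R S (@ga_ext F K G H)
  ga_ext_is_monoid_morphism.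

Lemma ga_ext_basis h : ga_ext K (ga_basis F h) = ga_basis K h :> S.
Proof.
by apply: gaP => k; rewrite !ga_ofE; case: eqP; rewrite ?scale1r ?scale0r.
Qed.

Variables (l : nat) (alpha : l.-tuple K).

Lemma phiZ x (a : 'rV[R]_l) : phi alpha (x *: a) = ga_ext K x * phi alpha a.
Proof.
rewrite /phi mulr_sumr; apply: eq_bigr => i _.
by rewrite mxE rmorphM scalerAr.
Qed.

(** The coefficient of phi a at h has the coefficients of the a_i at h as its
    coordinates in the family alpha. *)
Lemma phi_inj : free alpha -> injective (phi alpha : 'rV[R]_l -> S).
Proof.
move=> free_alpha a b eq_phi; apply/rowP => i; apply: gaP => h.
have coefE c : ga_coef (phi alpha c) h = \sum_j ga_coef (c 0 j) h *: alpha`_j.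
  rewrite (big_morph (fun y => ga_coef y h) (id1 := 0) (op1 := +%R)).
  - apply: eq_bigr => j _.
    by rewrite ga_coefZ ga_ofE -(tnth_nth 0) mulrC -scalerAl mul1r.
  - by move=> y z; rewrite ga_coefD.
  - exact: ga_coef0.
have := congr1 (fun y => coord alpha i (ga_coef y h)) eq_phi.
by rewrite !coefE !coord_sum_free.
Qed.

End ScalarExtension.

(** * Normal forms of components *)

Lemma idem_expr (A : nzRingType) (e : A) n : e * e = e -> (0 < n)%N -> e ^+ n = e.
Proof.
move=> ee; case: n => // n _; elim: n => [|n IHn]; first exact: expr1.
by rewrite exprS IHn.
Qed.

Section Components.

Variables (F : finFieldType) (K : fieldExtType F) (G : finGroupType).
Variable (H : {group G}).
Hypothesis abH : abelian H.
Hypothesis co_qH : coprime #|F| #|H|.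

Local Notation R := (grpalg F (subg_of H)).
Local Notation S := (grpalg K (subg_of H)).
Local Notation q := #|F|.
Local Notation l := (\dim {:K}).
Local Notation ext := (@ga_ext F K G H).

Lemma subg_mulC (a b : subg_of H) : (a * b = b * a)%g.
Proof. by apply: val_inj; apply: (centsP abH); apply: subgP. Qed.

Lemma R_mulC (x y : R) : x * y = y * x.
Proof. exact/ga_mulC/subg_mulC. Qed.

Lemma S_mulC (x y : S) : x * y = y * x.
Proof. exact/ga_mulC/subg_mulC. Qed.

Lemma q_gt1 : (1 < q)%N.
Proof. exact: finNzRing_gt1. Qed.

Lemma card_is_pcharX : exists p n, [/\ p \in [pchar F], (0 < n)%N & q = (p ^ n)%N].
Proof.
have [p _ charF] := finPcharP F; exists p, (logn p q).
have def_q : q = (p ^ logn p q)%N := card_pprimeChar charF.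
split=> //; rewrite lt0n; apply/eqP => n0.
by have := q_gt1; rewrite def_q n0.
Qed.

Lemma expK_card (c : K) : c ^+ (q ^ l) = c.
Proof.
by apply/eqP; rewrite -(Fermat's_little_theorem (aspacef K)) memvf.
Qed.

Lemma l_gt0 : (0 < l)%N.
Proof. exact: (adim_gt0 (aspacef K)). Qed.

Lemma R_frobenius : exists2 Q, (1 < Q)%N & forall x : R, x ^+ Q = x.
Proof.
have [p [n [charF n_gt0 def_q]]] := card_is_pcharX.
apply: (ga_frobenius subg_mulC charF n_gt0) => [c|].
  by rewrite -def_q expf_card.
by move: co_qH; rewrite card_sub def_q coprime_pexpl.
Qed.

Lemma S_frobenius : exists2 Q, (1 < Q)%N & forall x : S, x ^+ Q = x.
Proof.
have [p [n [charF n_gt0 def_q]]] := card_is_pcharX.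
have charK : p \in [pchar K] by rewrite pchar_lalg.
apply: (ga_frobenius subg_mulC charK (n := n * l)) => [|c|].
- by rewrite muln_gt0 n_gt0 l_gt0.
- by rewrite expnM -def_q expK_card.
by move: co_qH; rewrite card_sub def_q coprime_pexpl.
Qed.

Lemma R_enum (V : {vspace R}) :
  exists s : seq R, [/\ uniq s, s =i V & size s = (q ^ \dim V)%N].
Proof.
by rewrite cardE; apply: vspace_enum (enum_uniq F) _ => c; rewrite mem_enum.
Qed.

Lemma S_enum (V : {vspace S}) :
  exists s : seq S, [/\ uniq s, s =i V & size s = (q ^ (l * \dim V))%N].
Proof.
have [|sK [sK_uniq sK_mem sK_size]] := vspace_enum {:K} (enum_uniq F).
  by move=> c; rewrite mem_enum.
have [|s [s_uniq s_mem s_size]] := vspace_enum V sK_uniq.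
  by move=> c; rewrite sK_mem memvf.
by exists s; split=> //; rewrite s_size sK_size -cardE expnM.
Qed.

Lemma ext_corner (e : R) (eS : seq S) f : primitive_decomposition e eS ->
  f \in eS -> ext e * f = f.
Proof.
move=> [uniq_eS prim_eS ->] eSf; have prim_f := prim_eS f eSf.
rewrite mulr_suml (bigD1_seq f) //=; have [[_ ->] _] := prim_f.
rewrite big1_seq ?addr0 // => f' /andP[neq_f' eSf'].
by apply: (primitive_orthogonal S_mulC (prim_eS _ eSf')) => //; apply/eqP.
Qed.

Section Corner.

Variables (e : R) (f : S).
Hypotheses (prim_e : primitive_idempotent e) (f_neq0 : f != 0).
Hypothesis ef : ext e * f = f.

(* A field embeds in any nonzero ring. *)
Lemma ext_corner_inj u : u \in principal e -> ext u * f = 0 -> u = 0.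
Proof.
move=> eu uf0; have [//|u0] := eqVneq u 0.
have [Q Q_gt1 frobQ] := R_frobenius.
have [v _ vu] := corner_inverse R_mulC Q_gt1 frobQ prim_e eu u0.
by case/eqP: f_neq0; rewrite -ef -vu rmorphM -mulrA uf0 mulr0.
Qed.

Hypothesis ff : f * f = f.

(** Both Re and K embed in Sf, by u |-> u f and c |-> c f, so the power map fixes
    them.  It is additive and Sf' is spanned over K by (Re) f', so it fixes
    Sf'. *)
Lemma power_fixes_component m f' :
    (forall y, y \in principal f -> y ^+ (q ^ m) = y) ->
    f' * f' = f' -> ext e * f' = f' ->
  forall y, y \in principal f' -> y ^+ (q ^ m) = y.
Proof.
move=> fix_f ff' ef' y; rewrite (idem_principal _ ff') => /eqP yf'.
have [p [n [charF n_gt0 def_q]]] := card_is_pcharX.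
have charK : p \in [pchar K] by rewrite pchar_lalg.
have qm_gt0 : (0 < q ^ m)%N by rewrite expn_gt0 (ltnW q_gt1).
have [[e0 ee] _] := prim_e.
have fixR u : u \in principal e -> u ^+ (q ^ m) = u.
  move=> eu; apply/eqP; rewrite -subr_eq0; apply/eqP/ext_corner_inj.
    move: eu; rewrite !idem_principal // => /eqP ue.
    by rewrite mulrBl -(prednK qm_gt0) exprSr -mulrA ue.
  rewrite rmorphB rmorphXn mulrBl; apply/eqP; rewrite subr_eq0; apply/eqP.
  rewrite -[RHS]fix_f ?idem_principal // -?mulrA ?ff //.
  by rewrite exprMn_comm ?(idem_expr ff) //; apply: S_mulC.
have fixKm (c : K) : c ^+ (q ^ m) = c.
  have: (c *: f) ^+ (q ^ m) = c *: f.
    by rewrite fix_f // idem_principal // -scalerAl ff.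
  rewrite exprZn (idem_expr ff) // => /eqP; rewrite -subr_eq0 -scalerBl scaler_eq0.
  by rewrite (negPf f_neq0) orbF subr_eq0 => /eqP.
have -> : y = \sum_h ga_coef y h *: (ext (ga_basis F h * e) * f').
  rewrite -{1}yf' {1}(ga_expand y) mulr_suml; apply: eq_bigr => h _.
  by rewrite -scalerAl rmorphM /= ga_ext_basis -mulrA ef'.
have -> : (q ^ m = p ^ (n * m))%N by rewrite def_q expnM.
rewrite (ga_sumX subg_mulC) //; apply: eq_bigr => h _.
have -> : (p ^ (n * m) = q ^ m)%N by rewrite def_q expnM.
rewrite exprZn fixKm exprMn_comm ?(idem_expr ff') //; last exact: S_mulC.
by rewrite -rmorphXn fixR // idem_principal // -mulrA ee.
Qed.

End Corner.

(** Let M be the size of Sf.  Raising to the power M fixes Sf, hence also Sf', so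
    the order of pf' divides M - 1 and Sf' has at most M elements. *)
Lemma corner_dim_le e f f' pf pf' :
    primitive_idempotent e -> primitive_idempotent f -> primitive_idempotent f' ->
    ext e * f = f -> ext e * f' = f' ->
    primitive_element f pf -> primitive_element f' pf' ->
  (\dim (principal f') <= \dim (principal f))%N.
Proof.
move=> prim_e prim_f prim_f' ef ef' gen_f gen_f'.
have [Q Q_gt1 frobQ] := S_frobenius.
have [s [s_uniq s_mem s_size]] := S_enum (principal f).
have [s' [s'_uniq s'_mem s'_size]] := S_enum (principal f').
have [N_gt0 PN _ genP] :=
  primitive_element_order S_mulC Q_gt1 frobQ prim_f gen_f s_uniq s_mem.
have [N'_gt0 PN' inj' _] :=
  primitive_element_order S_mulC Q_gt1 frobQ prim_f' gen_f' s'_uniq s'_mem.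
have [[f0 ff] _] := prim_f; have [[f'0 ff'] _] := prim_f'.
have sK : (size s).-1.+1 = size s by case: (size s) N_gt0.
have s'K : (size s').-1.+1 = size s' by case: (size s') N'_gt0.
have fix_f y : y \in principal f -> y ^+ (q ^ (l * \dim (principal f))) = y.
  rewrite -s_size -sK => fy; have [->|y0] := eqVneq y 0.
    by rewrite expr0n.
  have [n _ ->] := genP y fy y0; have [f_pf _ _] := gen_f.
  have pff : pf * f = pf by apply/eqP; rewrite -idem_principal.
  rewrite exprMn_comm ?(idem_expr ff) //; last exact: S_mulC.
  rewrite exprAC exprS -{1}pff -mulrA PN pff; done.
have := power_fixes_component prim_e f0 ef ff fix_f ff' ef'.
have [f'_pf' pf'0 _] := gen_f'.
have [z _ zp] := corner_inverse S_mulC Q_gt1 frobQ prim_f' f'_pf' pf'0.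
move=> /(_ _ f'_pf'); rewrite -s_size -sK exprS.
move=> /(congr1 ( *%R z)); rewrite mulrA zp => fixN.
have le_N : ((size s').-1 <= (size s).-1)%N.
  rewrite leqNgt; apply/negP => lt_N.
  have := inj' 0%N (size s).-1 N'_gt0 lt_N; rewrite expr0 mulr1 fixN.
  by move=> /(_ erefl) N0; rewrite -N0 in N_gt0.
move: le_N; rewrite -ltnS sK s'K s_size s'_size.
by rewrite leq_exp2l ?q_gt1 // leq_pmul2l ?l_gt0.
Qed.


(** The unit x of Re is chosen for the first index t at which B has a nonzero
    component; at the later indices any exponent is allowed. *)
Lemma component_normal_form (e : R) (eS : seq S) (pi : nat -> S) (B : S) :
    primitive_idempotent e -> primitive_decomposition e eS ->
    (forall i, (i < size eS)%N -> primitive_element eS`_i (pi i)) ->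
    ext e * B = B -> B != 0 ->
  exists x y : R, [/\ x * e = x, y * x = e
    & component_form q l (\dim (principal e)) eS pi (ext x * B)].
Proof.
move=> prim_e dec_e gen_pi eB B0; have [uniq_eS prim_eS sum_eS] := dec_e.
have [[e0 ee] _] := prim_e.
have [QR QR_gt1 frobR] := R_frobenius; have [QS QS_gt1 frobS] := S_frobenius.
have prim_i i : (i < size eS)%N -> primitive_idempotent eS`_i.
  by move=> lt_i; apply/prim_eS/mem_nth.
have ext_i i : (i < size eS)%N -> ext e * eS`_i = eS`_i.
  by move=> lt_i; apply: (ext_corner dec_e); apply: mem_nth.
have sumB C : ext e * C = C -> C = \sum_(0 <= i < size eS) C * eS`_i.
  move=> eC; rewrite -{1}eC sum_eS mulr_suml (big_nth 0).
  by apply: eq_bigr => i _; apply: S_mulC.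
set d := \dim (principal eS`_0).
have dim_i i : (i < size eS)%N -> \dim (principal eS`_i) = d.
  move=> lt_i; have lt_0 : (0 < size eS)%N by apply: leq_trans lt_i.
  have le_dim j k : (j < size eS)%N -> (k < size eS)%N ->
      (\dim (principal (eS`_k)%R) <= \dim (principal (eS`_j)%R))%N.
    move=> lt_j lt_k; apply: (corner_dim_le prim_e (prim_i _ lt_j) (prim_i _ lt_k)).
    - exact: ext_i.
    - exact: ext_i.
    - exact: gen_pi.
    - exact: gen_pi.
  by apply/eqP; rewrite eqn_leq !le_dim.
have ex_t : exists t, (t < size eS)%N && (B * eS`_t != 0).
  have [/existsP[i Bi0]|] := boolP [exists i : 'I_(size eS), B * eS`_i != 0].
    by exists i; rewrite ltn_ord.
  rewrite negb_exists => /forallP B_0; case/eqP: B0.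
  rewrite (sumB B eB) big_mkord big1 // => i _.
  by apply/eqP; rewrite -[_ == _]negbK B_0.
case: (ex_minnP ex_t) => t /andP[lt_t Bt0] min_t {ex_t}.
have prim_t := prim_i t lt_t; have [[f0 ff] _] := prim_t.
have ef := ext_i t lt_t; have gen_t := gen_pi t lt_t.
have pi_t : pi t \in principal eS`_t by case: gen_t.
have [s [s_uniq s_mem s_size]] := S_enum (principal eS`_t).
have [N_gt0 PN P_inj genP] :=
  primitive_element_order S_mulC QS_gt1 frobS prim_t gen_t s_uniq s_mem.
pose P n := eS`_t * pi t ^+ n.
have PD m n : P (m + n)%N = P m * P n by exact: (cpowD S_mulC).
have P0 : P 0%N = eS`_t by rewrite /P expr0 mulr1.
(* U is the image of the multiplicative group of Re in S e_t. *)
have [sR [sR_uniq sR_mem sR_size]] := R_enum (principal e).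
have sR0 : 0 \in sR by rewrite sR_mem mem0v.
have Re x : (x \in principal e) = (x * e == x) by exact: idem_principal.
pose U := [seq ext x * eS`_t | x <- rem 0 sR].
have mem_rem x : (x \in rem 0 sR) = (x != 0) && (x * e == x).
  by rewrite mem_rem_uniq // inE sR_mem Re.
have inj_ext x y : x * e = x -> y * e = y ->
    ext x * eS`_t = ext y * eS`_t -> x = y.
  move=> xe ye /eqP; rewrite -subr_eq0 -mulrBl -rmorphB => /eqP xy0.
  apply/eqP; rewrite -subr_eq0; apply/eqP.
  by apply: (ext_corner_inj prim_e f0 ef _ xy0); rewrite Re mulrBl xe ye.
have U_uniq : uniq U.
  rewrite map_inj_in_uniq ?rem_uniq // => x y.
  by rewrite !mem_rem => /andP[_ /eqP xe] /andP[_ /eqP ye]; apply: inj_ext.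
have U1 : P 0%N \in U.
  by apply/mapP; exists e; rewrite ?P0 ?ef // mem_rem e0 ee eqxx.
have UP u : u \in U -> exists2 n, (n < (size s).-1)%N & u = P n.
  case/mapP => x; rewrite mem_rem => /andP[x0 /eqP xe] ->; apply: genP.
    by rewrite idem_principal // -mulrA ff.
  apply: contra_neq x0 => xf0; apply: (ext_corner_inj prim_e f0 ef _ xf0).
  by rewrite Re xe.
have UM u v : u \in U -> v \in U -> u * v \in U.
  move=> /mapP[x Ux ->] /mapP[y Uy ->]; apply/mapP; exists (x * y).
    move: Ux Uy; rewrite !mem_rem => /andP[x0 /eqP xe] /andP[y0 /eqP ye].
    rewrite -mulrA ye eqxx andbT; apply/negP => /eqP xy0.
    have [||/eqP|/eqP] := corner_integral R_mulC QR_gt1 frobR prim_e _ _ xy0.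
    - by rewrite Re xe.
    - by rewrite Re ye.
    - by apply/negP.
    - by apply/negP.
  rewrite rmorphM -!mulrA; congr (_ * _).
  by rewrite mulrA (S_mulC eS`_t) -mulrA ff.
have Bt_corner : B * eS`_t \in principal eS`_t.
  by rewrite idem_principal // -mulrA ff.
have [m _ def_m] := genP _ Bt_corner Bt0.
have sub_exp := subgroup_exponent N_gt0 PD _ P_inj U_uniq U1 UP UM.
have [|w Uw [nut lt_nut def_nut]] := sub_exp _ m; first by rewrite P0.
case/mapP: Uw => x; rewrite mem_rem => /andP[x0 /eqP xe] def_w.
have Rx : x \in principal e by rewrite Re xe.
have [y _ yx] := corner_inverse R_mulC QR_gt1 frobR prim_e Rx x0.
exists x, y; split=> //.
have L_nut : (nut < Lnum q l (\dim (principal e)) d)%N.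
  move: lt_nut; rewrite /U size_map size_rem // sR_size s_size dim_i //.
  by rewrite /Lnum !subn1.
have ex_nu i : exists v, (i < size eS)%N ==>
    in_T q l d v && (ext x * B * eS`_i == epow eS`_i (pi i) v).
  have [lt_i|] := boolP (i < size eS)%N; last by exists None.
  have [[_ ffi] _] := prim_i i lt_i.
  have pi_i : pi i \in principal eS`_i by case: (gen_pi i lt_i).
  have [xB0|xB0] := eqVneq (ext x * B * eS`_i) 0; first by exists None; apply/eqP.
  have [si [si_uniq si_mem si_size]] := S_enum (principal eS`_i).
  have [_ _ _ genPi] := primitive_element_order S_mulC QS_gt1 frobS (prim_i i lt_i)
    (gen_pi i lt_i) si_uniq si_mem.
  have [|n lt_n def_n] := genPi _ _ xB0.
    by rewrite idem_principal // -(mulrA (ext x * B)) ffi.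
  exists (Some n); rewrite /= -/(epow _ _ (Some n)) (epow_corner S_mulC) //.
  rewrite def_n eqxx andbT.
  by move: lt_n; rewrite si_size dim_i // subn2; case: (_ ^ _)%N => [|[]].
pose nu i := xchoose (ex_nu i).
have nuP i (lt_i : (i < size eS)%N) : in_T q l d (nu i) /\
    ext x * B * eS`_i = epow eS`_i (pi i) (nu i).
  by have /implyP/(_ lt_i)/andP[? /eqP] := xchooseP (ex_nu i).
exists t, nut, nu; split=> //.
- by rewrite subn1 -ltnS prednK // (leq_ltn_trans _ L_nut).
- by move=> i /andP[_ lt_i]; case: (nuP i lt_i).
rewrite (epow_corner S_mulC) // -/(P nut) -def_nut def_w.
rewrite (sumB (ext x * B)); last by rewrite mulrA -rmorphM R_mulC xe.
rewrite (big_cat_nat (n := t)) //= ?(ltnW lt_t) // big_nat big1 ?add0r; last first.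
  move=> i /andP[_ lt_it]; rewrite -mulrA; suff -> : B * eS`_i = 0 by rewrite mulr0.
  apply/eqP/negPn/negP => Bi0; have := min_t i.
  by rewrite (ltn_trans lt_it lt_t) Bi0 leqNgt lt_it => /(_ isT).
rewrite big_ltn //; congr (_ + _).
  by rewrite -mulrA def_m -/(P m) -[in RHS]mulrA -P0 -PD.
by apply: eq_big_nat => i /andP[_ lt_i]; case: (nuP i lt_i).
Qed.

End Components.

Theorem corollary3p13
  (F : finFieldType) (G : finGroupType) (abG : abelian [set: G])
  (H : {group G}) (l : nat) (idxH : #|[set: G] : H|%g = l)
  (coprime_qH : coprime #|F| #|H|)
  (K : fieldExtType F) (dimK : \dim {:K} = l)
  (g : 'I_l -> G) (g_repr : coset_representatives H g)
  (alpha : l.-tuple K) (alpha_basis : basis_of {:K} alpha)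
  (r : nat) (e : 'I_r -> grpalg F (subg_of H)) (e_inj : injective e)
  (e_prim : forall j, primitive_idempotent (e j))
  (eS : 'I_r -> seq (grpalg K (subg_of H)))
  (eS_decomp : forall j, primitive_decomposition (e j) (eS j))
  (pi : 'I_r -> nat -> grpalg K (subg_of H))
  (pi_prim : forall (j : 'I_r) (i : nat), (i < size (eS j))%N ->
     primitive_element (eS j)`_i (pi j i))
  (C : {vspace grpalg F G}) (C_1gen : one_generator_code H C)
  (C_idem : has_idempotent_generator g C (\sum_(j < r) e j)) :
  exists A : 'I_r -> grpalg K (subg_of H),
    (forall j : 'I_r,
       [/\ A j \in principal (ga_ext K (e j)), A j != 0 &
           component_form #|F| l (\dim (principal (e j))) (eS j) (pi j) (A j)])
    /\ generated_by g alpha (\sum_(j < r) A j) C.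

Proof.
have abH : abelian H by apply: abelianS abG; apply: subsetT.
have SC := S_mulC (K := K) abH; have RC := R_mulC (F := F) abH.
have free_alpha := basis_free alpha_basis.
have [[_ ee] [a [gen_a prin_e]]] := C_idem.
set eT := \sum_(j < r) e j in ee prin_e.
have idem_e j : e j * e j = e j by case: (e_prim j) => [[]].
have e_orth i j : i != j -> e i * e j = 0.
  by move=> neq_ij; apply: (primitive_orthogonal RC) => // /e_inj/eqP; apply/negP.
have eT_e j : eT * e j = e j.
  rewrite mulr_suml (bigD1 j) //= idem_e big1 ?addr0 // => i neq_ij; exact: e_orth.
have a_eT i : a 0 i * eT = a 0 i.
  apply/eqP; rewrite -idem_principal // prin_e.
  have le_i : (principal (a 0%R i) <= \sum_(k < l) principal (a 0%R k))%VS.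
    exact: (sumv_sup i).
  by apply/(subvP le_i)/memv_principal; exists 1; rewrite mul1r.
set A0 := phi alpha a.
have eT_A0 : ga_ext K eT * A0 = A0.
  by rewrite -phiZ; congr (phi _ _); apply/rowP => i; rewrite mxE RC a_eT.
have A0_neq0 j : ga_ext K (e j) * A0 != 0.
  have [[ej0 _] _] := e_prim j.
  rewrite -phiZ; apply: contra_neq ej0 => phi0.
  (* e j kills all a_i, hence the ideal they generate, hence itself. *)
  have ja0 : e j *: a = 0.
    by apply: (phi_inj free_alpha); rewrite phi0 -(scale0r a) phiZ rmorph0 mul0r.
  have : e j \in (\sum_(i < l) principal (a 0%R i))%VS.
    by rewrite -prin_e idem_principal // RC eT_e.
  move=> /memv_sumP[b b_mem def_ej]; rewrite -(idem_e j) {2}def_ej mulr_sumr.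
  apply: big1 => i _; have /memv_principal[y ->] := b_mem i isT.
  have /rowP/(_ i) := ja0.
  by rewrite !mxE mulrA (RC _ y) -mulrA => ->; rewrite mulr0.
have nf j : exists x y : grpalg F (subg_of H),
    [/\ x * e j = x, y * x = e j
      & component_form #|F| l (\dim (principal (e j))) (eS j) (pi j)
          (ga_ext K x * (ga_ext K (e j) * A0))].
  have := component_normal_form abH coprime_qH (e_prim j) (eS_decomp j)
    (pi_prim j) _ (A0_neq0 j).
  by rewrite mulrA -rmorphM idem_e dimK; apply.
have [x {}/fin_all_exists[y xyP]] := fin_all_exists nf.
exists (fun j => ga_ext K (x j) * (ga_ext K (e j) * A0)); split=> [j|c].
  have [xe yx form] := xyP j; split=> //.
    rewrite idem_principal -?rmorphM ?idem_e // mulrA -rmorphM xe.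
    by rewrite -mulrA (SC A0) mulrA -rmorphM xe.
  apply: contra_neq (A0_neq0 j) => xA0.
  by rewrite -(idem_e j) -{1}yx !rmorphM -!mulrA xA0 mulr0.
pose X := \sum_(j < r) x j; pose Y := \sum_(j < r) y j * e j.
have YX : Y * X = eT.
  rewrite mulr_suml; apply: eq_bigr => j _; have [xe yx _] := xyP j.
  rewrite mulr_sumr (bigD1 j) //= -mulrA (RC (e j)) xe yx.
  rewrite big1 ?addr0 // => k neq_kj; have [xke _ _] := xyP k.
  by rewrite -xke (RC (x k)) -mulrA (mulrA (e j)) e_orth ?mul0r ?mulr0 // eq_sym.
have -> : \sum_(j < r) ga_ext K (x j) * (ga_ext K (e j) * A0) = ga_ext K X * A0.
  rewrite rmorph_sum mulr_suml; apply: eq_bigr => j _.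
  by rewrite mulrA -rmorphM; have [-> _ _] := xyP j.
split=> [/gen_a[z ->]|[z def_c]].
  exists (z * Y); rewrite phiZ mulrA -rmorphM -mulrA YX rmorphM -mulrA.
  by rewrite eT_A0.
apply/gen_a; exists (z * X); apply: (phi_inj free_alpha).
by rewrite def_c phiZ rmorphM mulrA.
Qed.
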